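(* Consider a regular hexagon of radius $1$ with an exit placed at an unknown vertex, and two robots starting at any two arbitrary vertices of the hexagon. For every (deterministic) evacuation algorithm, the worst-case evacuation time (over the six possible positions of the exit) is at least $2+\sqrt{3}$.
   Context: The hexagon is regular with circumradius $1$ (so side length $1$). Two robots move in the plane with speed at most $1$; a robot learns the location of the exit only when it is at that vertex; robots can exchange information only when they are at the same point at the same time (face-to-face communication). The robots know each other's (deterministic) algorithms. The evacuation time for a given exit vertex is the time when both robots have reached the exit. *)

(* Defs.v *)
From mathcomp Require Import all_boot all_order all_algebra.
From mathcomp Require Import all_classical all_reals all_analysis.
Set Implicit Arguments.
Unset Strict Implicit.
Unset Printing Implicit Defensive.
Import Order.TTheory GRing.Theory Num.Theory.
Local Open Scope ring_scope.
Local Open Scope classical_set_scope.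

(* Euclidean distance; the library norm on [R * R] is the sup norm. *)
Definition dist (R : realType) (x y : R * R) : R :=
  Num.sqrt ((x.1 - y.1) ^+ 2 + (x.2 - y.2) ^+ 2).

Definition vertex (R : realType) (k : 'I_6) : R * R :=
  (cos (k%:R * (pi / 3)), sin (k%:R * (pi / 3))).

(* [runs R] lists the motion of the two robots (indexed by [bool]) for each
   possible exit: [p e i t] is the position of robot [i] at time [t] when the
   exit is at [vertex e].  Only times [t >= 0] are meaningful. *)
Definition runs (R : realType) : Type := 'I_6 -> bool -> R -> R * R.

Definition at_exit (R : realType) (p : runs R) (e : 'I_6) (i : bool) (t : R) :
    Prop :=
  p e i t = vertex R e.

Definition meet (R : realType) (p : runs R) (e : 'I_6) (t : R) : Prop :=
  p e false t = p e true t.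

(* Robot [i] gets the same answers to "is the exit here?" up to time [t],
   whether the exit is at [e] or at [e']. *)
Definition same_sightings (R : realType) (p : runs R) (e e' : 'I_6) (i : bool)
    (t : R) : Prop :=
  forall s : R, 0 <= s <= t -> (at_exit p e i s <-> at_exit p e' i s).

(* Up to time [t], robot [i] cannot tell the exits [e] and [e'] apart: it has
   the same sightings and the same meetings, and at each meeting the other
   robot, handing over its whole history, has the same sightings to report
   (meetings are common to both robots, so they need not be reported).
   That a meeting takes place in one run and not in the other is information
   too: a robot knows the algorithm of its partner. *)
Definition same_view (R : realType) (p : runs R) (e e' : 'I_6) (i : bool)
    (t : R) : Prop :=
  [/\ same_sightings p e e' i t,
      (forall s : R, 0 <= s <= t -> (meet p e s <-> meet p e' s)) &
      (forall s : R, 0 <= s <= t -> meet p e s ->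
         same_sightings p e e' (~~ i) s)].

(* A pair of deterministic algorithms, one per robot, for the starting vertices
   [start], given by the runs it produces.  [pos_local] says that the position
   of a robot is a function of time and of its own view.  [pos_det] says that
   the exit sightings are the only external input of the system; it does not
   follow from [pos_local], because meetings are an effect of the motion: two
   robots staying together could otherwise separate at a time depending on the
   (unseen) exit, this separation being its own justification. *)
Record algorithm (R : realType) (start : bool -> 'I_6) : Type := Algorithm {
  pos : runs R;
  pos_start : forall (e : 'I_6) (i : bool), pos e i 0 = vertex R (start i);
  pos_speed : forall (e : 'I_6) (i : bool) (s t : R), 0 <= s -> s <= t ->
    dist (pos e i s) (pos e i t) <= t - s;
  pos_local : forall (e e' : 'I_6) (i : bool) (t : R), 0 <= t ->
    same_view pos e e' i t -> pos e i t = pos e' i t;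
  pos_det : forall (e e' : 'I_6) (t : R), 0 <= t ->
    (forall i : bool, same_sightings pos e e' i t) ->
    forall i : bool, pos e i t = pos e' i t }.

(* [+oo] if some robot never reaches the exit. *)
Definition evacuation_time (R : realType) (start : bool -> 'I_6)
    (A : algorithm R start) (e : 'I_6) : \bar R :=
  ereal_inf [set T%:E | T in [set T : R | forall i : bool,
    exists2 t : R, 0 <= t <= T & at_exit (pos A) e i t]].

Definition worst_case_evacuation_time (R : realType) (start : bool -> 'I_6)
    (A : algorithm R start) : \bar R :=
  \big[maxe/-oo%E]_(e < 6) evacuation_time A e.

(* Main.v *)
(* Let [D e] be the first time at which a robot sees the exit when it is at
   [e]; until then the run does not depend on [e].  A robot needs time 1 between
   two vertices, so at most two vertices have [D e < 1] and at most four have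
   [D e < 2].  Take [w], [w'] with [2 <= D w <= D w'].  With the exit at [w'],
   the finder of [w] still has to travel from [w], hence
   [D w < 1 + sqrt 3] if evacuation takes less than [2 + sqrt 3].  As [w] has
   only two neighbours, some [c <> w] with [1 <= D c] is not adjacent to [w],
   i.e. at distance at least [sqrt 3].  Neither the finder of [c] nor news of
   it can get from [c] to [w] between [D c] and [D w]; so, with the exit at [c],
   some robot is at [w] at time [D w >= 2] and has to travel [sqrt 3] more. *)
Require Import Defs.
From mathcomp Require Import all_boot all_order all_algebra.
From mathcomp Require Import all_classical all_reals all_analysis.
From mathcomp Require Import ring lra zify.
Import Order.TTheory GRing.Theory Num.Theory.
Local Open Scope ring_scope.

(** * Euclidean distance in the plane *)

Lemma dist_ge0 (R : realType) (x y : R * R) : 0 <= dist x y.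
Proof. exact: sqrtr_ge0. Qed.

Lemma distxx (R : realType) (x : R * R) : dist x x = 0.
Proof. by rewrite /dist !subrr expr0n /= addr0 sqrtr0. Qed.

Lemma distC (R : realType) (x y : R * R) : dist x y = dist y x.
Proof. by rewrite /dist -(sqrrN (x.1 - _)) -(sqrrN (x.2 - _)) !opprB. Qed.

Lemma dist0_eq (R : realType) (x y : R * R) : dist x y <= 0 -> x = y.
Proof.
move=> le0; have : dist x y == 0 by rewrite eq_le le0 dist_ge0.
case: x y {le0} => [x1 x2] [y1 y2]; rewrite sqrtr_eq0 /= => h.
have := sqr_ge0 (x1 - y1); have := sqr_ge0 (x2 - y2) => h2 h1.
have /eqP : (x1 - y1) ^+ 2 = 0 by lra.
have /eqP : (x2 - y2) ^+ 2 = 0 by lra.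
by rewrite !sqrf_eq0 !subr_eq0 => /eqP -> /eqP ->.
Qed.

Lemma dist_triangle (R : realType) (y x z : R * R) :
  dist x z <= dist x y + dist y z.
Proof.
case: x y z => [x1 x2] [y1 y2] [z1 z2]; rewrite /dist /=.
have -> : x1 - z1 = (x1 - y1) + (y1 - z1) by ring.
have -> : x2 - z2 = (x2 - y2) + (y2 - z2) by ring.
move: (x1 - y1) (x2 - y2) (y1 - z1) (y2 - z2) => a b c d.
have p0 : 0 <= a ^+ 2 + b ^+ 2 by rewrite addr_ge0 ?sqr_ge0.
have q0 : 0 <= c ^+ 2 + d ^+ 2 by rewrite addr_ge0 ?sqr_ge0.
(* Cauchy-Schwarz: the squares of the two sides differ by [(a * d - b * c) ^+ 2]. *)
have cs : a * c + b * d <=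
    Num.sqrt (a ^+ 2 + b ^+ 2) * Num.sqrt (c ^+ 2 + d ^+ 2).
  rewrite -sqrtrM // (le_trans (ler_norm _)) // -sqrtr_sqr ler_wsqrtr //.
  rewrite -subr_ge0; apply: le_trans (sqr_ge0 (a * d - b * c)) _.
  by rewrite le_eqVlt; apply/orP; left; apply/eqP; ring.
rewrite -(@ler_pXn2r _ 2) ?nnegrE ?addr_ge0 ?sqrtr_ge0 //.
rewrite [leRHS]sqrrD !sqr_sqrtr ?addr_ge0 ?sqr_ge0 //.
by move: cs; move: (_ * Num.sqrt _) => X; lra.
Qed.

(** * Coordinates and distances of the hexagon vertices *)

Lemma cos_pi3 (R : realType) : cos (pi / 3) = 2^-1 :> R.
Proof.
have pi0 := pi_gt0 R.
have c0 : 0 < cos (pi / 3 : R) by apply: cos_gt0_pihalf; lra.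
have : cos (pi / 3 + (pi / 3 + pi / 3)) = -1 :> R.
  by rewrite -cospi; congr cos; field.
rewrite cosD cosD sinD.
have := cos2Dsin2 (pi / 3 : R).
move: (cos _) (sin _) c0 => c s c0 h1 h2.
(* The triple-angle formula turns [cos pi = -1] into this equation; [c0] excludes the root [-1]. *)
have : (c + 1) * (2 * c - 1) ^+ 2 = 0.
  have e : s ^+ 2 = 1 - c ^+ 2 by lra.
  have -> : (c + 1) * (2 * c - 1) ^+ 2 =
    (c * (c * c - s * s) - s * (s * c + c * s)) + 1
      + 3 * c * (s ^+ 2 - (1 - c ^+ 2)) by ring.
  by rewrite h2 e; ring.
move/eqP; rewrite mulf_eq0 sqrf_eq0 => /orP[] /eqP ?; lra.
Qed.

Lemma sin_pi3 (R : realType) : sin (pi / 3) = Num.sqrt 3 / 2 :> R.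
Proof.
have pi0 := pi_gt0 R.
have s0 : 0 < sin (pi / 3 : R) by apply: sin_gt0_pi; lra.
have := cos2Dsin2 (pi / 3 : R); rewrite cos_pi3 => h.
apply/eqP; rewrite -(@eqrXn2 _ 2) ?(ltW s0) ?divr_ge0 ?sqrtr_ge0 //.
by rewrite expr_div_n sqr_sqrtr //; apply/eqP; lra.
Qed.

Lemma vertexE (R : realType) (k : 'I_6) (s := Num.sqrt 3 / 2 : R) :
  vertex R k = nth (0, 0) [:: (1, 0); (2^-1, s); (- 2^-1, s); (-1, 0);
                              (- 2^-1, - s); (2^-1, - s)] k.
Proof.
have h : s ^+ 2 = 3 / 4.
  by rewrite /s expr_div_n sqr_sqrtr //; lra.
(* Rotation by [pi / 3], through the addition formulas. *)
have step (m : nat) (a b a' b' : R) :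
    a / 2 - b * s = a' -> b / 2 + a * s = b' ->
    (cos (m%:R * (pi / 3)), sin (m%:R * (pi / 3))) = (a, b) ->
    (cos (m.+1%:R * (pi / 3)), sin (m.+1%:R * (pi / 3))) = (a', b').
  move=> <- <- [<- <-].
  rewrite -natr1 mulrDl mul1r cosD sinD cos_pi3 sin_pi3 -/s.
  by congr (_, _); ring.
have v0 : (cos (0%:R * (pi / 3)), sin (0%:R * (pi / 3))) = (1, 0) :> R * R.
  by rewrite mul0r cos0 sin0.
have v1 := step 0%N 1 0 2^-1 s ltac:(lra) ltac:(lra) v0.
have v2 := step 1%N 2^-1 s (- 2^-1) s ltac:(lra) ltac:(lra) v1.
have v3 := step 2%N (- 2^-1) s (-1) 0 ltac:(lra) ltac:(lra) v2.
have v4 := step 3%N (-1) 0 (- 2^-1) (- s) ltac:(lra) ltac:(lra) v3.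
have v5 := step 4%N (- 2^-1) (- s) 2^-1 (- s) ltac:(lra) ltac:(lra) v4.
rewrite /vertex; case: k => -[|[|[|[|[|[|//]]]]]] ? /=.
- exact: v0.
- exact: v1.
- exact: v2.
- exact: v3.
- exact: v4.
- exact: v5.
Qed.

Lemma dist_vertex_ge1 (R : realType) (j k : 'I_6) : j != k ->
  1 <= dist (vertex R j) (vertex R k).
Proof.
have h : Num.sqrt 3 ^+ 2 = 3 :> R by rewrite sqr_sqrtr.
rewrite -[X in X <= _]sqrtr1 !vertexE /dist => jk; apply: ler_wsqrtr.
by case: j k jk => -[|[|[|[|[|[|//]]]]]] ? [] [|[|[|[|[|[|//]]]]]] ? //= _; nra.
Qed.

(** Addition in ['I_6] is modulo 6, so the excluded set is [j] with its two neighbours. *)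
Lemma dist_vertex_ge_sqrt3 (R : realType) (j k : 'I_6) :
  k \notin [set j; j + 1; j - 1]%SET ->
  Num.sqrt 3 <= dist (vertex R j) (vertex R k).
Proof.
have h : Num.sqrt 3 ^+ 2 = 3 :> R by rewrite sqr_sqrtr.
rewrite !inE -!val_eqE !vertexE /dist => jk; apply: ler_wsqrtr.
by case: j k jk => -[|[|[|[|[|[|//]]]]]] ? [] [|[|[|[|[|[|//]]]]]] ? //= _; nra.
Qed.

(** * First sightings and runs that agree until then *)

Lemma first_time (R : realType) (S : R -> Prop) :
  (exists2 t, 0 <= t & S t) ->
  (forall t, 0 <= t -> ~ S t ->
    exists2 eps, 0 < eps & forall s, t <= s < t + eps -> ~ S s) ->
  exists t, [/\ 0 <= t, S t & forall s, 0 <= s < t -> ~ S s].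
Proof.
move=> [t1 t10 St1] Sopen.
pose E := [set t | 0 <= t /\ S t]%classic.
have E0 : (E !=set0)%classic by exists t1.
have lbE : lbound E 0 by move=> t [].
have infE : has_inf E by split=> //; exists 0.
have i0 : 0 <= inf E by apply: lb_le_inf.
have ile t : E t -> inf E <= t by move=> Et; apply: ge_inf => //; exists 0.
exists (inf E); split=> //.
(* If the infimum were outside [S], so would be an interval to its right, and it could not be
   approached from [E]. *)
- apply: contrapT => /(Sopen _ i0)[eps eps0 h].
  have [t Et tlt] := inf_adherent eps0 infE.
  by apply: (h t); [rewrite ile | case: Et].
- by move=> s /andP[s0 slt] Ss; have := ile s (conj s0 Ss); rewrite leNgt slt.
Qed.

(** The speed bound makes trajectories continuous, so agreement passes to the limit; at time 0 the
    start is common. *)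
Lemma pos_limit (R : realType) (start : bool -> 'I_6) (A : algorithm R start)
    (e e' : 'I_6) (i : bool) (t : R) : 0 <= t ->
  (forall s, 0 <= s < t -> pos A e i s = pos A e' i s) ->
  pos A e i t = pos A e' i t.
Proof.
rewrite le_eqVlt => /predU1P[<- _|t0 h]; first by rewrite !pos_start.
apply: dist0_eq; rewrite leNgt; apply/negP => d0.
pose d := dist (pos A e i t) (pos A e' i t).
(* From [s] to [t] each run moves the robot by at most [d / 4], too little to open a distance
   [d]. *)
pose s := Num.max 0 (t - d / 4).
have s0 : 0 <= s by rewrite le_max lexx.
have st : s < t by rewrite gt_max t0 /= /d; lra.
have std : t - d / 4 <= s by rewrite le_max lexx orbT.
have h1 := pos_speed A e i s0 (ltW st).
have h2 := pos_speed A e' i s0 (ltW st).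
have := dist_triangle _ (pos A e i s) (pos A e i t) (pos A e' i t).
rewrite {2}(h s) ?s0 // (distC _ _ (pos A e i s)) -/d.
by rewrite -/d in d0; lra.
Qed.

(** Both robots may arrive together at time [d]; [i] is then either of them. *)
Definition first_sighting (R : realType) (start : bool -> 'I_6)
    (A : algorithm R start) (e : 'I_6) (d : R) (i : bool) : Prop :=
  [/\ 0 <= d, at_exit (pos A) e i d &
      forall (s : R) (j : bool), 0 <= s < d -> ~ at_exit (pos A) e j s].

Lemma first_sighting_exists (R : realType) (start : bool -> 'I_6)
    (A : algorithm R start) (e : 'I_6) (i : bool) (t : R) :
  0 <= t -> at_exit (pos A) e i t ->
  exists d j, first_sighting R start A e d j.
Proof.
move=> t0 ht.
have [||d [d0 [j dj] dmin]] :=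
  first_time R (fun t => exists j, at_exit (pos A) e j t).
- by exists t => //; exists i.
- move=> u u0 nu.
  (* A robot at distance [g j] from the exit cannot be there within less than time [g j]. *)
  pose g j := dist (pos A e j u) (vertex R e).
  have g0 j : 0 < g j.
    by rewrite ltNge; apply/negP => /dist0_eq uj; apply: nu; exists j.
  exists (Num.min (g false) (g true)); first by rewrite lt_min !g0.
  move=> s /andP[us]; rewrite -ltrBlDl lt_min => /andP[sf st] [j sj].
  have := pos_speed A e j u0 us; rewrite sj -/(g j).
  by case: {sj} j; rewrite leNgt ?sf ?st.
by exists d, j; split=> // s k hs ek; apply: (dmin s hs); exists k.
Qed.

(** Before both sightings nothing is seen in either run, so [pos_det] applies. It fails to cover a
    time [t] equal to [d] or [d'], which [pos_limit] adds. *)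
Lemma pos_agree (R : realType) (start : bool -> 'I_6) (A : algorithm R start)
    (e e' : 'I_6) (d d' : R) (j j' i : bool) (t : R) :
  first_sighting R start A e d j -> first_sighting R start A e' d' j' ->
  0 <= t -> t <= d -> t <= d' -> pos A e i t = pos A e' i t.
Proof.
move=> [_ _ de] [_ _ de'] t0 td td'; apply: pos_limit => // s /andP[s0 st].
apply: pos_det => // k u /andP[u0 us]; split=> hu.
- by case: (de u k) => //; rewrite u0 (le_lt_trans us) // (lt_le_trans st).
- by case: (de' u k) => //; rewrite u0 (le_lt_trans us) // (lt_le_trans st).
Qed.

(** * Travel times forced by sightings *)

Lemma later_sighting (R : realType) (start : bool -> 'I_6)
    (A : algorithm R start) (e e' : 'I_6) (d d' : R) (i i' : bool) :
  first_sighting R start A e d i -> first_sighting R start A e' d' i' ->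
  d <= d' -> pos A e' i d = vertex R e.
Proof.
move=> he he' dd'; have [d0 ed _] := he.
by rewrite (pos_agree _ _ A e' e d' d i' i).
Qed.

Lemma sighting_gap (R : realType) (start : bool -> 'I_6)
    (A : algorithm R start) (e e' : 'I_6) (d d' : R) (i : bool) :
  first_sighting R start A e d i -> first_sighting R start A e' d' i ->
  d <= d' -> dist (vertex R e) (vertex R e') <= d' - d.
Proof.
move=> he he' dd'; have [d0 _ _] := he; have [_ e'd' _] := he'.
rewrite -(later_sighting _ _ A e e' d d' i i) // -e'd'.
exact: pos_speed.
Qed.

Lemma late_evacuation (R : realType) (start : bool -> 'I_6)
    (A : algorithm R start) (e e' : 'I_6) (d d' t : R) (i i' : bool) :
  first_sighting R start A e d i -> first_sighting R start A e' d' i' ->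
  d <= d' -> 0 <= t -> at_exit (pos A) e' i t ->
  d + dist (vertex R e) (vertex R e') <= t.
Proof.
move=> he he' dd' t0 et; have [d0 _ _] := he; have [_ _ min'] := he'.
have d't : d' <= t.
  by rewrite leNgt; apply/negP => tlt; apply: (min' t i); rewrite ?t0.
rewrite addrC -lerBrDr -(later_sighting _ _ A e e' d d' i i') // -et.
by apply: pos_speed => //; apply: le_trans d't.
Qed.

(* From its sighting at time [dc] on, the finder of [c] lies in the disk of
   radius [t - dc] around [c].  Robot [i], which is at [w] at time [dw], is
   still outside that disk by the triangle inequality: it can neither be told
   about the exit [c], nor notice the absence of its partner. *)
Lemma uninformed (R : realType) (start : bool -> 'I_6)
    (A : algorithm R start) (c w : 'I_6) (dc dw : R) (i : bool) :
  first_sighting R start A c dc (~~ i) -> first_sighting R start A w dw i ->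
  dw - dc < dist (vertex R c) (vertex R w) ->
  forall t : R, 0 <= t -> at_exit (pos A) c i t ->
  dw + dist (vertex R c) (vertex R w) <= t.
Proof.
move=> hc hw far tc tc0 ctc.
have [dc0 cdc cmin] := hc; have [dw0 wdw wmin] := hw.
have [dwc|dcw] := leP dw dc.
  by rewrite distC; apply: (late_evacuation _ _ A w c dw dc tc i (~~ i)).
have dctc : dc <= tc.
  by rewrite leNgt; apply/negP => tlt; apply: (cmin tc i); rewrite ?tc0.
(* [S] holds when robot [i] is in the growing disk around [c]; it is false before [dc], when the
   radius is negative. *)
pose S s := dist (pos A c i s) (vertex R c) <= s - dc.
have [||s0 [s00 Ss0 s0min]] := first_time R S.
- by exists tc => //; rewrite /S ctc distxx subr_ge0.
- move=> t t0 /negP; rewrite /S -ltNge => gap.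
  (* Half the gap: the robot approaches and the radius grows, each at rate at most 1. *)
  exists ((dist (pos A c i t) (vertex R c) - (t - dc)) / 2); first by lra.
  move=> s /andP[ts slt] hs.
  have := pos_speed A c i t0 ts.
  have := dist_triangle _ (pos A c i s) (pos A c i t) (vertex R c); lra.
have outside s : 0 <= s <= dw -> s - dc < dist (pos A w i s) (vertex R c).
  move=> /andP[s_ge0 sdw]; have := pos_speed A w i s_ge0 sdw.
  have := dist_triangle _ (pos A w i s) (vertex R c) (vertex R w).
  rewrite wdw [dist (vertex R c) (pos _ _ _ _)]distC; lra.
(* Used for both runs, as the partner is at [c] at time [dc] in the run for [w] too. *)
have reach e s : dc <= s -> pos A e (~~ i) dc = vertex R c -> meet (pos A) e s ->
    dist (pos A e i s) (vertex R c) <= s - dc.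
  move=> dcs ec ms; rewrite -ec distC.
  suff -> : pos A e i s = pos A e (~~ i) s by apply: pos_speed.
  by move: ms; rewrite /meet; case: (i) => ->.
have wdc : pos A w (~~ i) dc = vertex R c.
  by apply: (later_sighting _ _ A c w dc dw (~~ i) i) => //; apply: ltW.
(* Strictly before both [s0] and [dw], robot [i] has the same view in both runs: no exit is seen by
   anyone before [dc], and from [dc] on there is no meeting in either run. Seeing [c] would put [i]
   at the centre of the disk. *)
have agree t : 0 <= t -> t <= s0 -> t <= dw -> pos A c i t = pos A w i t.
  move=> t0 ts0 tdw; apply: pos_limit => // s /andP[s_ge0 st].
  have early u : 0 <= u <= s -> u < s0 /\ u < dw.
    by move=> /andP[_ us]; split; apply: le_lt_trans us _;
       apply: lt_le_trans st _.
  have nometc u : 0 <= u <= s -> dc <= u -> ~ meet (pos A) c u.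
    move=> hu dcu /(reach _ _ dcu cdc); have [us0 _] := early u hu.
    by apply: s0min; rewrite us0 andbT; case/andP: hu.
  have nometw u : 0 <= u <= s -> dc <= u -> ~ meet (pos A) w u.
    move=> hu dcu /(reach _ _ dcu wdc); have [_ uw] := early u hu.
    apply/negP; rewrite -ltNge; apply: outside.
    by rewrite (ltW uw) andbT; case/andP: hu.
  have same u j : 0 <= u -> u <= dc -> pos A c j u = pos A w j u.
    move=> u0 udc; apply: (pos_agree _ _ A c w dc dw (~~ i) i) => //.
    exact: le_trans udc (ltW dcw).
  apply: pos_local => //; split=> u hu.
  - have [us0 uw] := early u hu; case/andP: (hu) => u0 _.
    split=> hv; last by case: (wmin u i) => //; rewrite u0.
    have [dcu|udc] := leP dc u; last by case: (cmin u i) => //; rewrite u0.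
    by case: (s0min u); rewrite ?u0 // /S hv distxx subr_ge0.
  - case/andP: (hu) => u0 _; have [dcu|udc] := leP dc u.
      by split=> [/(nometc u hu dcu)|/(nometw u hu dcu)].
    by rewrite /meet !same // ltW.
  - move=> mu; have [dcu|udc] := leP dc u; first by case: (nometc u hu dcu).
    move=> v /andP[v0 vu]; have vdc := le_lt_trans vu udc.
    split=> hv; first by case: (cmin v (~~ i)) => //; rewrite v0.
    by case: (wmin v (~~ i)) => //; rewrite v0 (lt_trans vdc).
(* Entering the disk by time [dw] contradicts [outside]; otherwise [i] is at [w] at time [dw] with
   the exit at [c]. *)
have [s0dw|dws0] := leP s0 dw.
  have : s0 - dc < dist (pos A w i s0) (vertex R c) by rewrite outside ?s00.
  by rewrite -agree // ltNge (Ss0 : _ <= _).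
have dwtc : dw <= tc.
  rewrite (le_trans (ltW dws0)) // leNgt; apply/negP => tlt.
  by apply: (s0min tc); rewrite ?tc0 // /S ctc distxx subr_ge0.
rewrite addrC -lerBrDr distC -wdw -agree //; last exact: ltW.
by rewrite -ctc; apply: pos_speed.
Qed.

(** * Counting vertices by the time of their first sighting *)

Lemma not_evacuated_before (R : realType) (start : bool -> 'I_6)
    (A : algorithm R start) :
  ~ (forall (e : 'I_6) (i : bool),
      exists2 t : R, 0 <= t < 2 + Num.sqrt 3 & at_exit (pos A) e i t).
Proof.
move=> fast.
have /choice[D] : forall e, exists di : R * bool,
    first_sighting R start A e di.1 di.2.
  move=> e; have [t /andP[t0 _] et] := fast e true.
  by have [d [j h]] := first_sighting_exists _ _ A e true t t0 et; exists (d, j).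
move=> fs.
have D0 e : 0 <= (D e).1 by case: (fs e).
have gap e e' : e != e' -> (D e).2 = (D e').2 ->
    (D e).1 + 1 <= (D e').1 \/ (D e').1 + 1 <= (D e).1.
  wlog le : e e' / (D e).1 <= (D e').1 => [hw ne ef|ne ef].
    have [le|/ltW le] := leP (D e).1 (D e').1; first exact: hw.
    by rewrite or_comm; apply: hw => //; rewrite eq_sym.
  left; rewrite addrC -lerBrDr (le_trans (dist_vertex_ge1 R _ _ ne)) //.
  by apply: (sighting_gap _ _ A e e' _ _ (D e).2) => //; rewrite ef.
have card1 : (#|[set e | ((D e).1 < 1)%R]%SET| <= 2)%N.
  suff inj : {in [set e | ((D e).1 < 1)%R]%SET &, injective (fun e => (D e).2)}.
    by have := leq_card_in _ _ inj; rewrite card_bool.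
  move=> e e'; rewrite !inE => e1 e1' ef; apply/eqP/negP => /negP ne.
  by have := D0 e; have := D0 e'; case: (gap _ _ ne ef); lra.
have card2 : (#|[set e | ((D e).1 < 2)%R]%SET| <= 4)%N.
  suff inj : {in [set e | ((D e).1 < 2)%R]%SET &,
      (* Vertices with the same finder and in the same one of the intervals [0, 1) and [1, 2) would
         violate [gap]. *)
      injective (fun e => ((D e).2, (D e).1 < 1))}.
    by have := leq_card_in _ _ inj; rewrite card_prod card_bool.
  move=> e e'; rewrite !inE => e2 e2' [ef]; have := D0 e; have := D0 e'.
  move=> e'0 e0 e1; apply/eqP/negP => /negP /gap /(_ ef).
  by move: e1; have [] := ltP (D e).1 1; have [] := ltP (D e').1 1 => // *; lra.
have [w [w' [ww' w2 Dww']]] : exists w w' : 'I_6,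
    [/\ w != w', 2 <= (D w).1 & (D w).1 <= (D w').1].
  have /card_gt1P[u [v [+ + ne]]] : (1 < #|~: [set e | ((D e).1 < 2)%R]%SET|)%N.
    have := cardsC [set e | ((D e).1 < 2)%R]%SET; rewrite card_ord.
    by move: card2; lia.
  rewrite !inE -!leNgt => u2 v2.
  have [le|/ltW le] := leP (D u).1 (D v).1; first by exists u, v.
  by exists v, u; rewrite eq_sym.
have Dw : (D w).1 < 1 + Num.sqrt 3.
  have [t /andP[t0 t1] et] := fast w' (D w).2.
  have := late_evacuation _ _ A w w' _ _ t _ _ (fs w) (fs w') Dww' t0 et.
  have := dist_vertex_ge1 R _ _ ww'; lra.
have [c cw Dc] : exists2 c : 'I_6, c \notin [set w; w + 1; w - 1]%SET &
    1 <= (D c).1.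
  have card3 : (#|[set w; (w + 1)%R; (w - 1)%R]%SET| <= 3)%N.
    by rewrite finset.setUC cardsU1 cards2; case: (_ \notin _); case: (_ != _).
  (* At least [6 - 2 = 4] vertices are first seen at time 1 or later, too many for [w] and its
     neighbours. *)
  have /subsetPn[c] :
      ~~ (~: [set e | ((D e).1 < 1)%R] \subset [set w; w + 1; w - 1])%SET.
    apply/negP => /subset_leq_card.
    have := cardsC [set e | ((D e).1 < 1)%R]%SET; rewrite card_ord.
    by move: card1 card3; lia.
  by rewrite !inE -leNgt => c1 cw; exists c; rewrite ?inE.
have cw3 := dist_vertex_ge_sqrt3 R _ _ cw; rewrite distC in cw3.
have [t /andP[t0 t1] ct] := fast c (D w).2.
have [Dwc|Dcw] := leP (D w).1 (D c).1.
  have := late_evacuation _ _ A w c _ _ t _ _ (fs w) (fs c) Dwc t0 ct.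
  rewrite distC; lra.
(* A common finder would travel from [c] to [w], at least [sqrt 3], between times 1 and
   [1 + sqrt 3], the latter excluded. With distinct finders, the same bound on [D w - D c] is what
   [uninformed] requires. *)
have [fcw|fcw] := eqVneq (D c).2 (D w).2.
  have := fs c; rewrite fcw => fsc.
  have := sighting_gap _ _ A c w _ _ _ fsc (fs w) (ltW Dcw); lra.
have fsc : first_sighting R start A c (D c).1 (~~ (D w).2).
  by have := fs c; case: (D c).2 (D w).2 fcw => [] [].
have := uninformed _ _ A c w _ _ _ fsc (fs w) _ t t0 ct.
by move/(_ ltac:(lra)); lra.
Qed.

Theorem theorem2 (R : realType) (start : bool -> 'I_6)
    (A : algorithm R start) :
  ((2 + Num.sqrt 3)%:E <= worst_case_evacuation_time A)%E.
Proof.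
rewrite leNgt; apply/negP => lt; apply: (not_evacuated_before R start A) => e i.
have : (evacuation_time A e < (2 + Num.sqrt 3)%:E)%E.
  by apply: le_lt_trans lt; rewrite /worst_case_evacuation_time le_bigmax.
move=> /ereal_inf_lt[_ [T hT <-]]; rewrite lte_fin => Tlt.
have [t /andP[t0 tT] et] := hT i.
by exists t => //; rewrite t0 (le_lt_trans tT).
Qed.
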